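(* Let $S$ be an $E$-Ehresmann semigroup. Then the right ample identity holds in $S$ if and only if the generalized right ample identity holds in $S$.
   Context: Let $S$ be a semigroup and $E\subseteq S$ a subset of idempotents, with the natural partial order $e\le f\iff ef=fe=e$. For $a\in S$ put $a_E=\{e\in E\mid ae=a\}$ and ${}_E a=\{e\in E\mid ea=a\}$. Define equivalence relations on $S$ by $a\,\widetilde{\mathcal{L}}_E\,b\iff a_E=b_E$ and $a\,\widetilde{\mathcal{R}}_E\,b\iff {}_Ea={}_Eb$. $S$ is $E$-Fountain if every $\widetilde{\mathcal{L}}_E$-class and every $\widetilde{\mathcal{R}}_E$-class contains an element of $E$; it is reduced if moreover $ef=e\iff fe=e$ for all $e,f\in E$. In a reduced $E$-Fountain semigroup, for every $a\in S$ the sets $a_E$ and ${}_Ea$ have minimum elements with respect to $\le$, denoted $a^\ast$ and $a^+$ respectively. Congruence condition: $\widetilde{\mathcal{L}}_E$ is a right congruence and $\widetilde{\mathcal{R}}_E$ is a left congruence (equivalently, $(ab)^\ast=(a^\ast b)^\ast$ and $(ab)^+=(ab^+)^+$ for all $a,b\in S$). $S$ is $E$-Ehresmann if it is reduced $E$-Fountain, satisfies the congruence condition, and $E$ is a subsemilattice of $S$ (a commutative subsemigroup of idempotents). Right ample identity: $ea=a(ea)^\ast$ for every $a\in S$, $e\in E$. Generalized right ample identity: $\left(e\left(a(eaf)^\ast\right)^+\right)^\ast=\left(a(eaf)^\ast\right)^+$ for every $a\in S$ and $e,f\in E$. *)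

(* Defs.v *)
From mathcomp Require Import all_boot.
From mathcomp Require Import boolp classical_sets.
From Stdlib Require Import RelationClasses.

Set Implicit Arguments.
Unset Strict Implicit.
Unset Printing Implicit Defensive.

Local Open Scope classical_set_scope.
Local Open Scope group_scope.

Section EFountain.
Variable S : semigroupType.
Implicit Types (E A : set S) (R : S -> S -> Prop) (a b c e f : S).

Definition natural_le e f : Prop := e * f = e /\ f * e = e.

Definition right_ids E a : set S := [set e | E e /\ a * e = a].
Definition left_ids E a : set S := [set e | E e /\ e * a = a].

Definition tildeL E a b : Prop := right_ids E a = right_ids E b.
Definition tildeR E a b : Prop := left_ids E a = left_ids E b.

Definition idempotents E : Prop := E `<=` [set e | e * e = e].

Definition fountain E : Prop :=
  [/\ idempotents E,
      forall a, [set b | tildeL E a b] `&` E !=set0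
    & forall a, [set b | tildeR E a b] `&` E !=set0].

Definition reduced_fountain E : Prop :=
  fountain E /\ forall e f, E e -> E f -> (e * f = e <-> f * e = e).

Definition is_minimum A e : Prop := A e /\ forall f, A f -> natural_le e f.

(* [star E a] and [plus E a] are a^* and a^+; the default value [a] is never
   used when E is reduced and Fountain, see [starP] and [plusP]. *)
Definition star E a : S := xget a (is_minimum (right_ids E a)).
Definition plus E a : S := xget a (is_minimum (left_ids E a)).

Definition left_congruence R : Prop :=
  Equivalence R /\ forall a b c, R a b -> R (c * a) (c * b).
Definition right_congruence R : Prop :=
  Equivalence R /\ forall a b c, R a b -> R (a * c) (b * c).

Definition congruence_condition E : Prop :=
  right_congruence (tildeL E) /\ left_congruence (tildeR E).

Definition subsemilattice E : Prop :=
  [/\ idempotents E,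
      forall e f, E e -> E f -> E (e * f)
    & forall e f, E e -> E f -> e * f = f * e].

Definition ehresmann E : Prop :=
  [/\ reduced_fountain E, congruence_condition E & subsemilattice E].

Definition right_ample E : Prop :=
  forall a e, E e -> e * a = a * star E (e * a).

Definition generalized_right_ample E : Prop :=
  forall a e f, E e -> E f ->
    star E (e * plus E (a * star E (e * a * f)))
    = plus E (a * star E (e * a * f)).

Lemma is_minimum_uniq A e f : is_minimum A e -> is_minimum A f -> e = f.
Proof.
move=> [Ae min_e] [Af min_f].
by have [_ {1}<-] := min_e f Af; have [-> _] := min_f e Ae.
Qed.

Lemma starP E a : reduced_fountain E -> is_minimum (right_ids E a) (star E a).
Proof.
move=> [[idE LE _] red]; apply: xgetPex; have [e [eL Ee]] := LE a.
exists e; rewrite eL; split; first by split=> //; exact: idE.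
by move=> f [Ef ef]; split=> //; apply/red.
Qed.

Lemma plusP E a : reduced_fountain E -> is_minimum (left_ids E a) (plus E a).
Proof.
move=> [[idE _ RE] red]; apply: xgetPex; have [e [eR Ee]] := RE a.
exists e; rewrite eR; split; first by split=> //; exact: idE.
by move=> f [Ef fe]; split=> //; apply/red.
Qed.

End EFountain.

(* Main.v *)
Require Import Defs.
From mathcomp Require Import all_boot.
From mathcomp Require Import boolp classical_sets.

(** In an Ehresmann semigroup the generalized identity unfolds to an equation
    between elements of [S].  Put [x = a (eaf)^*].  Both [e] and [x^+] lie in
    the semilattice [E], so [(e x^+)^* = e x^+], and the generalized identity
    says [e x^+ = x^+].  As [x^+] is the least left identity of [x] in [E], this
    means [e x = x]; that is, [e a (eaf)^* = a (eaf)^*]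
    ([generalized_right_ampleE]).

    Choosing [f = (ea)^*] in this equation gives [ea = a (ea)^*], the right ample
    identity.  Conversely, the congruence condition gives
    [(eaf)^* = ((ea)^* f)^* = (ea)^* f] ([star_mulr]), which absorbs [(ea)^*] on
    its left, so right ampleness [ea = a (ea)^*], multiplied by [(eaf)^*], is the
    equation. *)

Local Open Scope group_scope.

Section Star.
Variables (S : semigroupType) (E : set S).
Implicit Types a b e f : S.

Lemma star_tildeL a b : reduced_fountain E -> tildeL E a b ->
  star E a = star E b.
Proof.
move=> redE eqL; have min_a := starP a redE; rewrite eqL in min_a.
exact: is_minimum_uniq min_a (starP b redE).
Qed.

Lemma tildeL_star a : reduced_fountain E -> tildeL E a (star E a).
Proof.
move=> redE; have [[Es as_a] min_s] := starP a redE.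
apply/seteqP; split=> f [Ef]; first by move=> af; have [? _] := min_s f (conj Ef af).
by move=> sf; split=> //; rewrite -as_a -mulgA sf.
Qed.

Lemma star_id e : reduced_fountain E -> E e -> star E e = e.
Proof.
move=> redE Ee; have [[idE _ _] red] := redE.
apply: is_minimum_uniq (starP e redE) _; split; first by split=> //; exact: idE.
by move=> f [Ef ef]; split=> //; apply/red.
Qed.

(** If [e] fixes [a^+] then it fixes [a = a^+ a]; the converse is the minimality
    of [a^+] among the left identities of [a]. *)
Lemma plus_left_id a e : reduced_fountain E -> E e ->
  e * plus E a = plus E a <-> e * a = a.
Proof.
move=> redE Ee; have [[_ pa] min_p] := plusP a redE; split=> [ep|ea].
  by rewrite -pa mulgA ep.
by have [] := min_p e (conj Ee ea).
Qed.

(** The congruence condition gives [(bf)^* = (b^* f)^*], and [b^* f] lies in [E]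
    because [E] is closed under products. *)
Lemma star_mulr b f : ehresmann E -> E f -> star E (b * f) = star E b * f.
Proof.
move=> [redE [[_ congL] _] [_ mulE _]] Ef.
rewrite (star_tildeL _ _ redE (congL _ _ f (tildeL_star b redE))).
by apply: star_id => //; apply: mulE => //; have [[]] := starP b redE.
Qed.

Lemma generalized_right_ampleE : ehresmann E ->
  generalized_right_ample E <->
  forall a e f, E e -> E f ->
    e * (a * star E (e * a * f)) = a * star E (e * a * f).
Proof.
move=> [redE _ [_ mulE _]].
have starM x e : E e -> star E (e * plus E x) = e * plus E x.
  by move=> Ee; apply/star_id/mulE => //; have [[]] := plusP x redE.
split=> H a e f Ee Ef.
  by apply/plus_left_id => //; rewrite -[LHS]starM //; exact: H.
by rewrite starM //; apply/plus_left_id => //; exact: H.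
Qed.

End Star.

Theorem proposition5p1 (S : semigroupType) (E : set S) (hE : ehresmann E) :
  right_ample E <-> generalized_right_ample E.
Proof.
have [redE _ [idE _ _]] := hE; rewrite generalized_right_ampleE //.
have starE x : E (star E x) by have [[]] := starP x redE.
have mul_star x : x * star E x = x by have [[]] := starP x redE.
split=> [ample a e f Ee Ef | gample a e Ee].
  rewrite star_mulr // mulgA; set s := star E (e * a).
  by rewrite (ample a e Ee) -/s -mulgA [s * (s * f)]mulgA idE //; exact: starE.
by have := gample a e _ Ee (starE (e * a)); rewrite mul_star mulgA mul_star.
Qed.
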